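(* Let $\mathbb{I}$ be a nonempty real interval, $n\geqslant1$, let $\mathsf{F}\colon\mathbb{I}^n\to\mathbb{R}$ be a function satisfying $\mathrm{ran}(\delta_{\mathsf{F}})=\mathrm{ran}(\mathsf{F})$ and let $\mathsf{G}\colon\mathbb{I}^n\to\mathbb{I}$ be any function. Then, assuming the Axiom of Choice (not necessary if $\delta_{\mathsf{F}}$ is monotonic), the following assertions are equivalent: (i) $\mathsf{F}=\delta_{\mathsf{F}}\circ\mathsf{G}$. (ii) For any $\mathbf{x}\in\mathbb{I}^n$, we have $\mathsf{G}(\mathbf{x})\in\delta_{\mathsf{F}}^{-1}\{\mathsf{F}(\mathbf{x})\}$. (iii) For any $\mathbf{x}\in\mathbb{I}^n$, there is $g_{\mathbf{x}}\in Q(\delta_{\mathsf{F}})$ such that $\mathsf{G}(\mathbf{x})=(g_{\mathbf{x}}\circ\mathsf{F})(\mathbf{x})$.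
   Context: $\delta_{\mathsf{F}}\colon\mathbb{I}\to\mathbb{R}$, $\delta_{\mathsf{F}}(x)=\mathsf{F}(x,\ldots,x)$, is the diagonal section of $\mathsf{F}$; $\mathrm{ran}$ and $\mathrm{dom}$ denote range and domain; $\delta_{\mathsf{F}}^{-1}\{y\}$ is the preimage of $\{y\}$. Monotonic means either nondecreasing or nonincreasing. A function $g$ (with $\mathrm{ran}(f)\subseteq\mathrm{dom}(g)$ and $\mathrm{ran}(g)\subseteq\mathrm{dom}(f)$) is a quasi-inverse of a function $f$ if $f\circ g|_{\mathrm{ran}(f)}=\mathrm{id}|_{\mathrm{ran}(f)}$ and $\mathrm{ran}(g|_{\mathrm{ran}(f)})=\mathrm{ran}(g)$. $Q(f)$ denotes the set of quasi-inverses of $f$. *)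

(* Defs.v *)
From Stdlib Require Export Reals Vector Ensembles Image ChoiceFacts.
From Stdlib Require Export Basics.

Open Scope R_scope.

Set Implicit Arguments.

Definition is_interval (I : Ensemble R) : Prop :=
  forall x y z : R, In R I x -> In R I y -> x <= z <= y -> In R I z.

(** A subset of a type, seen as a type.  A function on a subset [I] of [R] has
    type [carrier I -> _], and [I^n] is [Vector.t (carrier I) n]. *)
Definition carrier (T : Type) (A : Ensemble T) : Type := {x : T | In T A x}.

Definition ran (X Y : Type) (f : X -> Y) : Ensemble Y := Im X Y (Full_set X) f.

Definition preimage (X Y : Type) (f : X -> Y) (B : Ensemble Y) : Ensemble X :=
  fun x => In Y B (f x).

Definition diagonal_section (X Y : Type) (n : nat) (F : Vector.t X n -> Y)
  : X -> Y :=
  fun x => F (Vector.const x n).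

Definition nondecreasing (I : Ensemble R) (f : carrier I -> R) : Prop :=
  forall x y : carrier I, proj1_sig x <= proj1_sig y -> f x <= f y.

Definition nonincreasing (I : Ensemble R) (f : carrier I -> R) : Prop :=
  forall x y : carrier I, proj1_sig x <= proj1_sig y -> f y <= f x.

Definition monotonic (I : Ensemble R) (f : carrier I -> R) : Prop :=
  nondecreasing f \/ nonincreasing f.

(** Quasi-inverses of [f] need not be defined on all of the codomain of [f], and
    their behaviour outside [ran f] matters, so the domain is part of the data. *)
Record partial_function (Y X : Type) : Type := PartialFunction {
  dom : Ensemble Y;
  fn :> carrier dom -> X
}.

(** [ran g] is contained in the domain of [f] by typing, as [f] is total on [X].
    In the second conjunct [y] ranges over the points of [dom g] lying in
    [ran f], that is, over all of [ran f] in view of the first conjunct. *)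
Definition quasi_inverse (X Y : Type) (f : X -> Y) (g : partial_function Y X)
  : Prop :=
  Included Y (ran f) (dom g)
  /\ (forall y : carrier (dom g),
        In Y (ran f) (proj1_sig y) -> f (g y) = proj1_sig y)
  /\ Same_set X
       (Im (carrier (dom g)) X
           (fun y : carrier (dom g) => In Y (ran f) (proj1_sig y)) g)
       (ran g).

(* Main.v *)
Require Import Defs.
From Stdlib Require Import Classical FunctionalExtensionality Lra Constructive_sets.

(** Assertions (i) and (ii) say the same thing pointwise, by function
    extensionality, and (iii) gives (ii) because a quasi-inverse of [delta] is
    a right inverse of it on [ran delta], a set that contains all values of
    [F] by the hypothesis on ranges.

    The content is in (ii) => (iii).  A quasi-inverse of [delta] with domain
    exactly [ran delta] is just a section of [delta] over its range.  As soon as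
    one section exists, its value at the single point [F x] can be replaced by
    [G x], which lies over [F x] by (ii) ([quasi_inverse_through]).

    So choice matters only for finding one section.  The axiom of choice
    provides it at once.  If [delta] is monotonic, its fibres are intervals,
    and a point of a nonempty interval can be defined outright: [atan] turns
    the interval into a bounded one, the midpoint of the latter, between its
    infimum and supremum, belongs to it, and [tan] brings this midpoint back
    ([interval_point]).  The completeness of [R] yields suprema as data, which
    is why no choice principle enters there. *)

(** Under the order isomorphism [atan] onto a bounded open interval, unbounded
    intervals need no separate treatment. *)
Lemma interval_point (C : Ensemble R) :
  is_interval C -> Inhabited R C -> {c : R | In R C c}.
Proof.
  intros Hconv Hinh.
  destruct (completeness (fun t => exists r, In R C r /\ t = atan r))
    as [M [HMub HMleast]].
  { exists (PI / 2). intros t [r [_ ->]]. pose proof (atan_bound r). lra. }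
  { destruct Hinh as [r Hr]. exists (atan r), r. auto. }
  (* [m] is minus the infimum of [atan] on [C]. *)
  destruct (completeness (fun t => exists r, In R C r /\ t = - atan r))
    as [m [Hmub Hmleast]].
  { exists (PI / 2). intros t [r [_ ->]]. pose proof (atan_bound r). lra. }
  { destruct Hinh as [r Hr]. exists (- atan r), r. auto. }
  exists (tan ((M - m) / 2)).
  destruct Hinh as [x0 Hx0].
  assert (HM : forall r, In R C r -> atan r <= M) by (intros r Hr; apply HMub; eauto).
  assert (Hm : forall r, In R C r -> - atan r <= m) by (intros r Hr; apply Hmub; eauto).
  pose proof (HM x0 Hx0). pose proof (Hm x0 Hx0).
  (* If all values stayed strictly on one side of the midpoint, infimum and
     supremum would coincide, and the midpoint would be the value at [x0]. *)
  assert (Hb : exists b, In R C b /\ (M - m) / 2 <= atan b).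
  { apply NNPP. intros Hno.
    assert (Hlt : forall r, In R C r -> atan r < (M - m) / 2).
    { intros r Hr. apply Rnot_le_lt. intros Hle. apply Hno. eauto. }
    assert (M <= (M - m) / 2).
    { apply HMleast. intros t [r [Hr ->]]. apply Rlt_le. auto. }
    pose proof (Hlt x0 Hx0). lra. }
  assert (Ha : exists a, In R C a /\ atan a <= (M - m) / 2).
  { apply NNPP. intros Hno.
    assert (Hlt : forall r, In R C r -> (M - m) / 2 < atan r).
    { intros r Hr. apply Rnot_le_lt. intros Hle. apply Hno. eauto. }
    assert (m <= - ((M - m) / 2)).
    { apply Hmleast. intros t [r [Hr ->]]. pose proof (Hlt r Hr). lra. }
    pose proof (Hlt x0 Hx0). lra. }
  destruct Ha as [a [HaC Ha]], Hb as [b [HbC Hb]].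
  pose proof (atan_bound a). pose proof (atan_bound b).
  assert (Hmid : atan (tan ((M - m) / 2)) = (M - m) / 2)
    by (apply atan_tan; lra).
  apply (Hconv a b); [assumption | assumption | split].
  - apply Rnot_lt_le. intros Hlt. apply atan_increasing in Hlt. lra.
  - apply Rnot_lt_le. intros Hlt. apply atan_increasing in Hlt. lra.
Qed.

(** The fibre as a subset of [R] rather than of [carrier I], so that the order
    notions for [R] apply to it. *)
Definition real_fibre {I : Ensemble R} (f : carrier I -> R) (y : R)
  : Ensemble R :=
  fun r => exists r_in_I : In R I r, f (exist _ r r_in_I) = y.

Lemma real_fibre_interval {I : Ensemble R} (f : carrier I -> R) (y : R) :
  is_interval I -> monotonic f -> is_interval (real_fibre f y).
Proof.
  intros HI Hf a b z [HaI Ha] [HbI Hb] [Haz Hzb].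
  assert (HzI : In R I z) by (apply (HI a b); auto).
  exists HzI.
  destruct Hf as [Hf | Hf];
    pose proof (Hf (exist _ a HaI) (exist _ z HzI) Haz);
    pose proof (Hf (exist _ z HzI) (exist _ b HbI) Hzb); lra.
Qed.

Lemma ran_intro {X Y : Type} (f : X -> Y) (x : X) : In Y (ran f) (f x).
Proof. apply Im_intro with x; [constructor | reflexivity]. Qed.

(** The one place where choice or monotonicity is used. *)
Lemma section_exists {I : Ensemble R} {f : carrier I -> R} :
  is_interval I -> FunctionalChoice \/ monotonic f ->
  exists s : carrier (ran f) -> carrier I, forall y, f (s y) = proj1_sig y.
Proof.
  intros HI [AC | Hf].
  - apply (AC _ _ (fun (y : carrier (ran f)) x => f x = proj1_sig y)).
    intros [y Hy]. simpl. destruct Hy as [x _ y ->]. now exists x.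
  - assert (pt : forall y : carrier (ran f),
               {c : R | In R (real_fibre f (proj1_sig y)) c}).
    { intros [y Hy]. apply interval_point.
      - now apply real_fibre_interval.
      - simpl. destruct Hy as [[x Hx] _ y ->]. now exists x, Hx. }
    (* Membership in [I] is kept as a proof: only the real number is chosen. *)
    assert (inI : forall y c, In R (real_fibre f y) c -> In R I c)
      by (intros y c [Hc _]; exact Hc).
    exists (fun y => exist _ (proj1_sig (pt y)) (inI _ _ (proj2_sig (pt y)))).
    intros y. destruct (pt y) as [c Hc]. simpl.
    pose proof Hc as [HcI Hcy].
    etransitivity; [| exact Hcy].
    do 2 f_equal. apply proof_irrelevance.
Qed.

(** A map into the source with domain [ran f] meets the range condition on
    quasi-inverses automatically, so every section of [f] is a quasi-inverse. *)
Lemma section_quasi_inverse {X Y : Type} (f : X -> Y)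
  (s : carrier (ran f) -> X) :
  (forall y, f (s y) = proj1_sig y) ->
  quasi_inverse f {| dom := ran f; fn := s |}.
Proof.
  intros Hs. split; [| split].
  - intros y Hy. exact Hy.
  - intros y _. apply Hs.
  - split; intros x Hx; destruct Hx as [y _ x ->]; simpl;
      (apply Im_intro with y; [| reflexivity]).
    + constructor.
    + exact (proj2_sig y).
Qed.

(** Changing a section at the single point [f a] leaves it a section when the
    new value is [a]; decidable equality on [R] makes this modification
    definable. *)
Lemma quasi_inverse_through {X : Type} (f : X -> R)
  (s : carrier (ran f) -> X) (a : X) :
  (forall y, f (s y) = proj1_sig y) ->
  exists g : partial_function R X,
    quasi_inverse f g /\
    forall y : carrier (dom g), proj1_sig y = f a -> g y = a.
Proof.
  intros Hs.
  exists {| dom := ran f;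
            fn := fun y => if Req_dec_T (proj1_sig y) (f a) then a else s y |}.
  split.
  - apply section_quasi_inverse. intros y.
    destruct (Req_dec_T (proj1_sig y) (f a)); auto.
  - intros [y Hran] Hy. simpl in *.
    destruct (Req_dec_T y (f a)); [reflexivity | contradiction].
Qed.

Theorem proposition2p3
  (I : Ensemble R) (I_interval : is_interval I) (I_nonempty : Inhabited R I)
  (n : nat) (n_ge1 : (1 <= n)%nat)
  (F : Vector.t (carrier I) n -> R)
  (ran_diag : Same_set R (ran (diagonal_section F)) (ran F))
  (G : Vector.t (carrier I) n -> carrier I)
  (AC_or_monotonic : FunctionalChoice \/ monotonic (diagonal_section F)) :
  let delta := diagonal_section F in
  let assertion_i := F = compose delta G in
  let assertion_ii :=
    forall x : Vector.t (carrier I) n,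
      In (carrier I) (preimage delta (Singleton R (F x))) (G x) in
  let assertion_iii :=
    forall x : Vector.t (carrier I) n,
      exists g : partial_function R (carrier I),
        quasi_inverse delta g /\
        exists Fx_in_dom : In R (dom g) (F x),
          G x = g (exist (In R (dom g)) (F x) Fx_in_dom) in
  (assertion_i <-> assertion_ii) /\ (assertion_ii <-> assertion_iii).
Proof.
  intros delta assertion_i assertion_ii assertion_iii.
  assert (F_in_ran : forall x, In R (ran delta) (F x))
    by (intros x; apply (proj2 ran_diag), ran_intro).
  split; split.
  - intros Hi x. unfold In, preimage.
    assert (Hx : F x = delta (G x)) by exact (f_equal (fun h => h x) Hi).
    rewrite Hx. constructor.
  - intros Hii. apply functional_extensionality. intros x.
    exact (Singleton_inv _ _ _ (Hii x)).
  - intros Hii x.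
    pose proof (Singleton_inv _ _ _ (Hii x)) as Hx.
    destruct (section_exists I_interval AC_or_monotonic) as [s Hs].
    destruct (quasi_inverse_through delta s (G x) Hs) as [g [Hg Hgx]].
    exists g. split; [exact Hg |].
    exists (proj1 Hg _ (F_in_ran x)).
    symmetry. now apply Hgx.
  - intros Hiii x. destruct (Hiii x) as [g [[_ [Hsec _]] [Hdom HGx]]].
    unfold In, preimage. rewrite HGx, Hsec by apply F_in_ran. constructor.
Qed.
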